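(* Let $\Omega \subseteq \mathbb{R}^d$ be a bounded open convex set and $K \subseteq \mathbb{R}^d$ a compact set whose interior contains the origin. Then $d_{\mathrm{CT},K}$ is a distance on $\mathcal{P}(\Omega)$: (i) $d_{\mathrm{CT},K}(\mu_+,\mu_-) \geq 0$ for all $\mu_+,\mu_- \in \mathcal{P}(\Omega)$; (ii) $d_{\mathrm{CT},K}(\mu_+,\mu_-) = 0$ if and only if $\mu_+ = \mu_-$; (iii) for all $\mu_1,\mu_2,\mu_3 \in \mathcal{P}(\Omega)$, $d_{\mathrm{CT},K}(\mu_1,\mu_2) \leq d_{\mathrm{CT},K}(\mu_1,\mu_3) + d_{\mathrm{CT},K}(\mu_3,\mu_2)$.
   Context: $\mathcal{P}(\Omega)$ is the set of Borel probability measures on $\Omega$. Let $\mathcal{A} = \{ u : \Omega \to \mathbb{R} \,:\, u \text{ convex and } \nabla u \in K \text{ almost everywhere}\}$. The Choquet–Toland discrepancy is $D_{\mathrm{CT},K}(\mu_+\|\mu_-) = \sup_{\nu \in \mathcal{P}(K)} \{\frac12 W_2^2(\mu_+,\nu) - \frac12 W_2^2(\mu_-,\nu)\}$ ($W_2$ the 2-Wasserstein distance), the Variational Dominance Criterion is $\mathrm{VDC}_K(\mu_+\|\mu_-) = \sup_{u\in\mathcal{A}} \int_\Omega u\, d(\mu_- - \mu_+)$, and the Choquet–Toland distance is $d_{\mathrm{CT},K}(\mu_+,\mu_-) = D_{\mathrm{CT},K}(\mu_+\|\mu_-) + D_{\mathrm{CT},K}(\mu_-\|\mu_+)$, which (by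 Toland duality) equals $\mathrm{VDC}_K(\mu_+\|\mu_-) + \mathrm{VDC}_K(\mu_-\|\mu_+)$. *)

(* Defs.v *)
From HB Require Import structures.
From mathcomp Require Import all_boot all_order all_algebra.
From mathcomp Require Import all_classical all_reals all_analysis.
Set Implicit Arguments. Unset Strict Implicit. Unset Printing Implicit Defensive.
Import Order.TTheory GRing.Theory Num.Theory.
Import numFieldNormedType.Exports.
Local Open Scope classical_set_scope.
Local Open Scope ring_scope.

(* R^d as row vectors 'rV[R]_d, equipped with its Borel sigma-algebra
   (generated by the open sets of the product = Euclidean topology). *)
Definition Rd (R : realType) (d : nat) :=
  g_sigma_algebraType (@open 'rV[R]_d).

Definition sqdist (R : realType) (d : nat) (x y : 'rV[R]_d) : R :=
  \sum_(i < d) (x ord0 i - y ord0 i) ^+ 2.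

Definition coupling (R : realType) (d : nat)
    (mu nu : probability (Rd R d) R)
    (pi : probability (Rd R d * Rd R d)%type R) : Prop :=
  (forall A : set (Rd R d), measurable A -> pi (fst @^-1` A) = mu A) /\
  (forall B : set (Rd R d), measurable B -> pi (snd @^-1` B) = nu B).

Definition W2sq (R : realType) (d : nat) (mu nu : probability (Rd R d) R)
  : \bar R :=
  ereal_inf [set (\int[pi]_z (sqdist (z.1 : 'rV[R]_d) (z.2 : 'rV[R]_d))%:E)%E
            | pi in [set pi | coupling mu nu pi]].

(* nu is (the extension by zero of) a probability measure on S *)
Definition prob_on (R : realType) (d : nat) (S : set 'rV[R]_d)
    (mu : probability (Rd R d) R) : Prop :=
  mu (S : set (Rd R d)) = 1%E.

Definition D_CT (R : realType) (d : nat) (K : set 'rV[R]_d)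
    (mup mum : probability (Rd R d) R) : \bar R :=
  ereal_sup [set ((2^-1)%:E * W2sq mup nu - (2^-1)%:E * W2sq mum nu)%E
            | nu in [set nu | prob_on K nu]].

Definition d_CT (R : realType) (d : nat) (K : set 'rV[R]_d)
    (mup mum : probability (Rd R d) R) : \bar R :=
  (D_CT K mup mum + D_CT K mum mup)%E.

(* Main.v *)
Require Import Defs.
From HB Require Import structures.
From mathcomp Require Import all_boot all_order all_algebra.
From mathcomp Require Import all_classical all_reals all_analysis.
Import Order.TTheory GRing.Theory Num.Theory.
Import numFieldNormedType.Exports.
From mathcomp Require Import measurable_realfun ring lra.
Set Implicit Arguments. Unset Strict Implicit. Unset Printing Implicit Defensive.
Local Open Scope classical_set_scope.
Local Open Scope ring_scope.

(* The only delicate point is that d_CT mu1 mu2 = 0 forces mu1 = mu2.  If it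
   vanishes then W2^2(mu1, nu) - W2^2(mu2, nu) is a constant c over nu in P(K).
   Let u be a maximum of finitely many affine functions with slopes in K, let
   h be a measurable selection of its subgradients and nu the image of mu1
   under h.  With phi = |x|^2 - 2 u and psi = |y|^2 - 2 u^*, weak duality
   bounds W2^2(mu2, nu) below by the dual value of (phi, psi), while the
   coupling (id, h) bounds W2^2(mu1, nu) above by it; hence c is at most the
   difference of the integrals of phi.  Exchanging mu1 and mu2 gives equality,
   and since c does not depend on u, the integral of the difference of two
   such functions u is the same for mu1 and mu2.  Rescaled differences of
   max(0, m) and max(-e, m) approximate the indicator of {m < 0} as e -> 0,
   and the polytopes {m < 0} form a pi-system generating the Borel sets.  This
   argument replaces Toland duality. *)

(** * Borel sets of ['rV[R]_d] *)

Section borel.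
Context (R : realType) (d : nat).
Implicit Types (A S : set (Rd R d)).

Lemma open_measurable_Rd (A : set 'rV[R]_d) : open A -> measurable (A : set (Rd R d)).
Proof. by move=> oA; apply: sub_sigma_algebra. Qed.

Lemma closed_measurable_Rd (A : set 'rV[R]_d) : closed A -> measurable (A : set (Rd R d)).
Proof.
move=> cA; rewrite -[A]setCK; apply: (@measurableC _ (Rd R d)).
apply: open_measurable_Rd; exact: closed_openC.
Qed.

Lemma compact_measurable_Rd (A : set 'rV[R]_d) : compact A -> measurable (A : set (Rd R d)).
Proof. by move/compact_closed => h; apply: closed_measurable_Rd; exact/h/norm_hausdorff. Qed.

Lemma singleton_measurable_Rd (y : 'rV[R]_d) : measurable ([set y] : set (Rd R d)).
Proof. apply: compact_measurable_Rd; exact: compact_set1. Qed.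

Lemma measurable_coord (i : 'I_d) :
  measurable_fun [set: Rd R d] (fun x : Rd R d => (x : 'rV[R]_d) ord0 i).
Proof.
apply: (measurability _ (RGenOInfty.measurableE R)) => _ [_ [a ->] <-].
rewrite setTI; apply: open_measurable_Rd; apply: open_comp; last exact: interval_open.
by move=> x _; exact: coord_continuous.
Qed.

End borel.

(** * Image measures and integrability under a probability *)

Lemma prob_pushforward d1 d2 (T1 : measurableType d1) (T2 : measurableType d2)
    (R : realType) (P : probability T1 R) (f : T1 -> T2) : measurable_fun setT f ->
  exists Q : probability T2 R, forall A, Q A = P (f @^-1` A).
Proof.
move=> mf.
pose m := isMeasurableFun.Build _ _ _ _ f mf.
pose F : {mfun T1 >-> T2} := HB.pack f m.
by exists (distribution P F).
Qed.

Section prob.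
Context d (T : measurableType d) (R : realType).

Lemma prob1_setC0 (P : probability T R) (S : set T) :
  measurable S -> P S = 1%E -> P (~` S) = 0%E.
Proof. by move=> mS PS; rewrite probability_setC// [X in (_ - X)%E]PS subee. Qed.

(** The complement of [S] is negligible, so integrability can be checked on [S], where [f] is
    bounded and the measure finite. *)
Lemma prob_bounded_integrable (P : probability T R) (S : set T) (f : T -> R) (M : R) :
  measurable S -> P S = 1%E -> measurable_fun setT f ->
  (forall x, S x -> `|f x| <= M) -> P.-integrable setT (EFin \o f).
Proof.
move=> mS PS mf fM.
apply/(@negligible_integrable _ _ _ P setT (~` S)) => //.
- exact: measurableC.
- exact/measurable_EFinP.
- exact: prob1_setC0.
rewrite setDE setCK setTI; apply: measurable_bounded_integrable => //.
- by rewrite [ltLHS]PS ltry.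
- exact: measurable_funTS.
- exists M; split=> [|y My x Sx]; first by rewrite num_real.
  exact: le_trans (fM x Sx) (ltW My).
Qed.

End prob.

(** * Change of variables *)

Section image.
Context d1 d2 (T1 : measurableType d1) (T2 : measurableType d2) (R : realType).
Context (P : {measure set T1 -> \bar R}) (Q : {measure set T2 -> \bar R}).
Context (h : T1 -> T2) (mh : measurable_fun setT h).
Hypothesis Qh : forall A, measurable A -> Q A = P (h @^-1` A).

(** The hypothesis [Qh], in place of an equation with [pushforward P h], covers both the marginals
    of a coupling, where [h] is a projection, and image measures. *)
Lemma image_ge0_integral (f : T2 -> \bar R) :
  measurable_fun setT f -> (forall y, 0 <= f y)%E ->
  (\int[Q]_y f y = \int[P]_x f (h x))%E.
Proof.
move=> mf f0; rewrite (eq_measure_integral (pushforward P h)).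
  by rewrite ge0_integral_pushforward// preimage_setT.
by move=> A mA _; exact: Qh.
Qed.

Lemma image_integrable (f : T2 -> R) : measurable_fun setT f ->
  P.-integrable setT (EFin \o (f \o h)) <-> Q.-integrable setT (EFin \o f).
Proof.
move=> mf.
have E : (\int[Q]_x `|(EFin \o f) x| = \int[P]_x `|(EFin \o (f \o h)) x|)%E.
  by rewrite image_ge0_integral//; apply/measurableT_comp => //; exact/measurable_EFinP.
split=> /integrableP[mi fi]; apply/integrableP; split=> //.
- exact/measurable_EFinP.
- by rewrite E.
- by apply/measurable_EFinP; exact: measurableT_comp.
- by rewrite -E.
Qed.

Lemma image_Rintegral (f : T2 -> R) : measurable_fun setT f ->
  P.-integrable setT (EFin \o (f \o h)) ->
  \int[Q]_y f y = \int[P]_x f (h x).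
Proof.
move=> mf fi; rewrite /Rintegral (eq_measure_integral (pushforward P h)); last first.
  by move=> A mA _; exact: Qh.
rewrite integral_pushforward ?preimage_setT//.
exact/measurable_EFinP.
Qed.

End image.

(** * Affine functions and the pi-system of open polytopes *)

Section affine.
Context (R : realType) (d : nat).
Implicit Types (q : 'rV[R]_d * R) (L : seq ('rV[R]_d * R)) (x y : 'rV[R]_d).

Definition aff q x : R := \sum_(i < d) q.1 ord0 i * x ord0 i + q.2.

Lemma measurable_aff q : measurable_fun [set: Rd R d] (aff q : Rd R d -> R).
Proof.
apply: measurable_funD => //; apply: measurable_sum => i.
by apply: measurable_funM => //; exact: measurable_coord.
Qed.

Lemma aff_delta (i : 'I_d) (a c : R) x :
  aff (a *: delta_mx ord0 i, c) x = a * x ord0 i + c.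
Proof.
rewrite /aff (bigD1 i)//= big1 ?addr0 => [|j ji]; rewrite !mxE eqxx.
  by rewrite eqxx mulr1.
by rewrite (negbTE ji) mulr0 mul0r.
Qed.

Definition polytope L : set (Rd R d) := [set x | all (fun q => aff q x < 0) L].

Definition slopes_in (K : set 'rV[R]_d) L := forall q, q \in L -> K q.1.

Lemma measurable_polytope L : measurable (polytope L).
Proof.
elim: L => [|q L IH]; first by rewrite (_ : polytope _ = setT)//; exact/seteqP.
rewrite (_ : polytope _ = (setT `&` (aff q : Rd R d -> R) @^-1` `]-oo, 0[%classic) `&` polytope L).
  by apply: measurableI => //; apply: measurable_aff.
apply/seteqP; split=> x /=; rewrite in_itv/=.
  by move=> /andP[].
by move=> [[_ ? ?]]; exact/andP.
Qed.

Lemma polytopeI L1 L2 : polytope L1 `&` polytope L2 = polytope (L1 ++ L2).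
Proof.
apply/seteqP; split=> x; rewrite /polytope/= all_cat; first by move=> [-> ->].
by move=> /andP[].
Qed.

Lemma slopes_in_cat K L1 L2 :
  slopes_in K L1 -> slopes_in K L2 -> slopes_in K (L1 ++ L2).
Proof. by move=> h1 h2 q; rewrite mem_cat => /orP[/h1|/h2]. Qed.

(** Balls of ['rV[R]_d] are sup-norm cubes, cut out by two half-spaces per coordinate. Multiplying
    each inequality by a small [s > 0] leaves the half-space unchanged and brings its slope into the
    neighbourhood of 0 contained in [K]. *)
Lemma ball_polytope (K : set 'rV[R]_d) x (e : R) : (interior K) 0 -> 0 < e ->
  exists2 L, slopes_in K L & ball x e = polytope L.
Proof.
move=> /nbhs_ballP[r /= r0 rK] e0; pose s := r / 2.
have s0 : 0 < s by rewrite divr_gt0.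
have sr : s < r by rewrite /s; lra.
pose L1 := [seq (s *: delta_mx ord0 i : 'rV[R]_d, - (s * (x ord0 i + e))) | i <- enum 'I_d].
pose L2 := [seq (- s *: delta_mx ord0 i : 'rV[R]_d, s * (x ord0 i - e)) | i <- enum 'I_d].
have dK (a : R) i : `|a| < r -> K (a *: delta_mx ord0 i).
  move=> ar; apply: rK; split=> // j k; rewrite !mxE /ball/= sub0r normrN normrM.
  rewrite (le_lt_trans _ ar)// ler_piMr//.
  by case: (_ && _); rewrite ?normr1 ?normr0.
exists (L1 ++ L2).
  apply: slopes_in_cat => q /mapP[i _ ->]/=; apply: dK; rewrite ?normrN gtr0_norm//.
apply/seteqP; split=> y; rewrite /polytope/= all_cat !all_map.
  move=> [_ /(_ ord0)]; rewrite /ball/= => xy; apply/andP; split; apply/allP => i _ /=;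
    move: (xy i); rewrite aff_delta ltr_norml => /andP[]; nra.
move=> /andP[/allP h1 /allP h2]; split=> // j k; rewrite (ord1 j) /ball/=.
have kT : k \in Finite.enum 'I_d by rewrite -enumT mem_enum.
have := h1 k kT; have := h2 k kT; rewrite /= !aff_delta => a b.
rewrite ltr_norml; apply/andP; split; rewrite -(ltr_pM2l s0); lra.
Qed.

Lemma rat_row_approx (x : 'rV[R]_d) (e : R) : 0 < e ->
  exists q : 'rV[rat]_d, ball x e (map_mx ratr q).
Proof.
move=> e0.
have /choice[f fP] (i : 'I_d) : exists q : rat, `|x ord0 i - ratr q| < e.
  have xne : ball (x ord0 i) e !=set0 by exists (x ord0 i); exact: ballxx.
  have [y []] := dense_rat xne (ball_open _ _).
  by rewrite /ball/= => xy [q _ qy]; exists q; rewrite qy.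
exists (\row_i f i); split=> // i j; rewrite !mxE (ord1 i); exact: fP.
Qed.

(** Every open set is a countable union of cubes with rational centres and radii [1/(n+1)], and
    these cubes are polytopes. *)
Lemma measurable_polytopes (K : set 'rV[R]_d) : (interior K) 0 ->
  @measurable _ (Rd R d) = <<s [set polytope L | L in slopes_in K] >>.
Proof.
move=> K0; apply/seteqP; split; last first.
  apply: smallest_sub; first exact: sigma_algebra_measurable.
  by move=> _ [L _ <-]; exact: measurable_polytope.
apply: smallest_sub; first exact: smallest_sigma_algebra.
move=> U oU.
pose B (i : 'rV[rat]_d * nat) : set 'rV[R]_d := ball (map_mx ratr i.1 : 'rV[R]_d) i.2.+1%:R^-1.
(* Cubes that are not inside [U] become empty, so that the union can run over a whole countable
   type. *)
pose F i := if `[< B i `<=` U >] then B i else set0.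
have -> : U = \bigcup_i F i.
  apply/seteqP; split=> x; last first.
    by move=> [i _]; rewrite /F; case: asboolP => // h /h.
  move=> Ux; have := oU; rewrite openE => /(_ x Ux) /nbhs_ballP[e /= e0 eU].
  have e20 : 0 < e / 2 by rewrite divr_gt0.
  have [n _ /(_ n (leqnn n))/= ne] := near_infty_natSinv_lt (PosNum e20).
  have n0 : 0 < n.+1%:R^-1 :> R by rewrite invr_gt0.
  have [q xq] := rat_row_approx x n0.
  exists (q, n) => //; rewrite /F; case: asboolP => [_|]; first exact/ball_sym.
  case=> y /= qy; apply: eU; apply: le_ball (ball_triangle xq qy).
  by rewrite (splitr e) lerD// ltW.
apply: (@countable_bigcupT_measurable _ (g_sigma_algebraType [set polytope L | L in slopes_in K])).
  exact: countableP.
move=> i; rewrite /F; case: asboolP => _; last exact: measurable0.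
apply: sub_sigma_algebra.
have [|L LK BL] := @ball_polytope K (map_mx ratr i.1) i.2.+1%:R^-1 K0; first by rewrite invr_gt0.
by exists L.
Qed.

(** Polytopes are stable under intersection and the empty list gives the whole space, so a pi-lambda
    argument applies. *)
Lemma polytope_measure_unique (K : set 'rV[R]_d) (m1 m2 : probability (Rd R d) R) :
  (interior K) 0 ->
  (forall L, slopes_in K L -> m1 (polytope L) = m2 (polytope L)) ->
  forall A : set (Rd R d), measurable A -> m1 A = m2 A.
Proof.
move=> K0 m12 A mA.
apply: (measure_unique [set polytope L | L in slopes_in K] (fun=> setT)) => //.
- exact: measurable_polytopes.
- move=> _ _ [L1 L1K <-] [L2 L2K <-]; exists (L1 ++ L2); last by rewrite polytopeI.
  exact: slopes_in_cat.
- by move=> _; exists [::] => //; exact/seteqP.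
- by rewrite bigcup_const//; exists 0%N.
- by move=> _ [L LK <-]; exact: m12.
- by move=> _; apply: (@le_lt_trans _ _ 1%E); [exact: probability_le1|rewrite ltry].
Qed.

End affine.

(** * Couplings, and upper and lower bounds on [W2sq] *)

Section transport.
Context (R : realType) (d : nat).
Local Notation T := (Rd R d).
Local Notation cost := (fun z : T * T => sqdist (z.1 : 'rV[R]_d) (z.2 : 'rV[R]_d)).
Implicit Types (mu nu : probability T R) (A S : set T).

Lemma sqdist_ge0 (x y : 'rV[R]_d) : 0 <= sqdist x y.
Proof. by apply: sumr_ge0 => i _; exact: sqr_ge0. Qed.

Lemma measurable_sqdist : measurable_fun [set: T * T] cost.
Proof.
apply: measurable_sum => i; apply: measurable_funX; apply: measurable_funB.
- exact: measurableT_comp (measurable_coord i) measurable_fst.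
- exact: measurableT_comp (measurable_coord i) measurable_snd.
Qed.

Lemma measurable_sqdistE : measurable_fun [set: T * T] (EFin \o cost).
Proof. by apply/measurable_EFinP; exact: measurable_sqdist. Qed.

Lemma coupling_setXC0 mu nu pi A S : coupling mu nu pi ->
  measurable A -> measurable S -> mu A = 1%E -> nu S = 1%E ->
  pi (~` (A `*` S)) = 0%E.
Proof.
move=> [pimu pinu] mA mS muA nuS.
rewrite (_ : ~` _ = fst @^-1` (~` A) `|` snd @^-1` (~` S)); last first.
  by rewrite -!preimage_setC -setCI.
rewrite measureU0.
- by rewrite [LHS]pimu ?prob1_setC0//; exact: measurableC.
- by rewrite -[X in measurable X]setTI; apply: measurable_fst => //; exact: measurableC.
- by rewrite -[X in measurable X]setTI; apply: measurable_snd => //; exact: measurableC.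
- by rewrite [LHS]pinu ?prob1_setC0//; exact: measurableC.
Qed.

Lemma coupling_exists mu nu : exists pi, coupling mu nu pi.
Proof.
exists (mu \x nu)%E; split=> A mA.
  have -> : fst @^-1` A = A `*` [set: T] by apply/seteqP; split=> x //= [].
  by rewrite [LHS]product_measure1E//= probability_setT mule1.
have -> : snd @^-1` A = [set: T] `*` A by apply/seteqP; split=> x //= [].
by rewrite [LHS]product_measure1E//= probability_setT mul1e.
Qed.

Lemma W2sq_ge0 mu nu : (0 <= W2sq mu nu)%E.
Proof.
by apply: le_ereal_inf_tmp => _ [pi _ <-]; apply: integral_ge0 => z _; rewrite lee_fin sqdist_ge0.
Qed.

Lemma W2sq_fin_num mu nu A S (M : R) : measurable A -> measurable S ->
  mu A = 1%E -> nu S = 1%E ->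
  (forall x y, A x -> S y -> sqdist x y <= M) -> W2sq mu nu \is a fin_num.
Proof.
move=> mA mS muA nuS cM; rewrite ge0_fin_numE ?W2sq_ge0//.
have [pi cpi] := coupling_exists mu nu.
apply: (@le_lt_trans _ _ (\int[pi]_z (cost z)%:E)%E).
  by apply: ereal_inf_lbound; exists pi.
rewrite -ge0_fin_numE; last by apply: integral_ge0 => z _; rewrite lee_fin sqdist_ge0.
apply: integrable_fin_num => //.
apply: (@prob_bounded_integrable _ _ _ _ (A `*` S) _ M).
- exact: measurableX.
- rewrite -(setCK (A `*` S)) [LHS]probability_setC; last first.
    by apply: measurableC; exact: measurableX.
  by rewrite [X in (_ - X)%E](coupling_setXC0 cpi)// sube0.
- exact: measurable_sqdist.
- by move=> [x y] [/= Ax Sy]; rewrite ger0_norm ?sqdist_ge0//; exact: cM.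
Qed.

(** Weak Kantorovich duality: the pointwise inequality is integrated against an arbitrary coupling,
    whose marginals separate the two terms. It is assumed on [A] times [S], a set of full mass for
    every coupling. *)
Lemma W2sq_ge_dual mu nu A S (phi psi : T -> R) : measurable A -> measurable S ->
  mu A = 1%E -> nu S = 1%E ->
  measurable_fun setT phi -> measurable_fun setT psi ->
  mu.-integrable setT (EFin \o phi) -> nu.-integrable setT (EFin \o psi) ->
  (forall x y, A x -> S y -> phi x + psi y <= sqdist x y) ->
  ((\int[mu]_x phi x + \int[nu]_y psi y)%:E <= W2sq mu nu)%E.
Proof.
move=> mA mS muA nuS mphi mpsi iphi ipsi le_cost.
apply: le_ereal_inf_tmp => _ [pi cpi <-]; have [pimu pinu] := cpi.
have mAS : measurable (A `*` S) by exact: measurableX.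
have qmu B : measurable B -> mu B = pi (fst @^-1` B) by move=> /pimu.
have qnu B : measurable B -> nu B = pi (snd @^-1` B) by move=> /pinu.
have i1 := (image_integrable measurable_fst qmu mphi).2 iphi.
have i2 := (image_integrable measurable_snd qnu mpsi).2 ipsi.
rewrite (image_Rintegral measurable_fst qmu)// (image_Rintegral measurable_snd qnu)//.
rewrite -RintegralD//.
have ih := integrableD measurableT i1 i2.
rewrite /Rintegral fineK; last exact: integrable_fin_num.
rewrite (negligible_integral (N := ~` (A `*` S)))//; first last.
- exact: coupling_setXC0 cpi _ _ _ _.
- exact: measurableC.
rewrite setDE setCK setTI.
apply: (@le_trans _ _ (\int[pi]_(z in A `*` S) (cost z)%:E)%E); last first.
  apply: ge0_subset_integral => //; first exact: measurable_sqdistE.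
  by move=> z _; rewrite lee_fin sqdist_ge0.
have mh : measurable_fun setT (fun z => (phi z.1 + psi z.2)%:E).
  apply/measurable_EFinP; apply: measurable_funD.
    exact: measurableT_comp mphi measurable_fst.
  exact: measurableT_comp mpsi measurable_snd.
(* Dropping the negative part leaves a comparison of nonnegative functions, since the cost also
   dominates the positive part. *)
rewrite integralE -[leRHS]sube0 leeB//; last exact: integral_ge0.
apply: ge0_le_integral => //.
- by apply: measurable_funepos; exact: measurable_funTS.
- by apply: measurable_funTS; exact: measurable_sqdistE.
- move=> [x y] [/= Ax Sy]; rewrite funeposE ge_max !lee_fin sqdist_ge0 andbT.
  exact: le_cost.
Qed.

(** The image of [mu] under the graph map of [h] is an admissible coupling. *)
Lemma W2sq_le_image mu nu (h : T -> T) : measurable_fun setT h ->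
  (forall B, measurable B -> nu B = mu (h @^-1` B)) ->
  (W2sq mu nu <= \int[mu]_x (sqdist (x : 'rV[R]_d) (h x))%:E)%E.
Proof.
move=> mh nuh.
have mg : measurable_fun setT (fun x => (x, h x)) by apply: measurable_fun_pair.
have [pi pig] := prob_pushforward mu mg.
rewrite -(@image_ge0_integral _ _ _ _ _ mu pi _ mg _ (EFin \o cost)).
- apply: ereal_inf_lbound; exists pi => //; split=> B mB; rewrite pig//.
  by rewrite nuh.
- by move=> B _; exact: pig.
- exact: measurable_sqdistE.
- by move=> z; rewrite lee_fin sqdist_ge0.
Qed.

End transport.

(** * Maxima of affine functions and their subgradients *)

Section max_affine.
Context (R : realType) (d : nat).
Implicit Types (q : 'rV[R]_d * R) (L : seq ('rV[R]_d * R)) (x y : 'rV[R]_d).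

(** The head [q] is a separate argument so that the maximum is over a nonempty list. *)
Fixpoint max_aff q L x : R :=
  if L is q' :: L' then Num.max (aff q' x) (max_aff q L' x) else aff q x.

(** The slope of a piece attaining the maximum is a subgradient at [x]; selecting it by finitely
    many comparisons makes the choice measurable. *)
Fixpoint max_aff_slope q L x : 'rV[R]_d :=
  if L is q' :: L' then
    if max_aff q L' x < aff q' x then q'.1 else max_aff_slope q L' x
  else q.1.

Lemma measurable_max_aff q L :
  measurable_fun [set: Rd R d] (max_aff q L : Rd R d -> R).
Proof.
elim: L => [|q' L IH]; first exact: measurable_aff.
by apply: measurable_maxr => //; exact: measurable_aff.
Qed.

Lemma measurable_max_aff_slope q L :
  measurable_fun [set: Rd R d] (max_aff_slope q L : Rd R d -> Rd R d).
Proof.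
elim: L => [|q' L IH]; first exact: measurable_cst.
apply: measurable_fun_ifT => //.
by apply: measurable_fun_ltr; [exact: measurable_max_aff|exact: measurable_aff].
Qed.

Lemma aff_le_max q L x q' : q' \in q :: L -> aff q' x <= max_aff q L x.
Proof.
elim: L => [|q1 L IH]; first by rewrite inE => /eqP ->.
rewrite !inE /= le_max => /or3P[qq|/eqP ->|qL]; rewrite ?lexx// IH ?orbT//.
  by rewrite inE qq.
by rewrite inE qL orbT.
Qed.

Lemma max_aff_slopeP q L x : exists2 q', q' \in q :: L &
  max_aff_slope q L x = q'.1 /\ max_aff q L x = aff q' x.
Proof.
elim: L => [|q1 L [q' q'L [IH1 IH2]]]; first by exists q; rewrite ?inE.
rewrite /= maxC /Num.max; case: ifPn => _.
  by exists q1 => //; rewrite !inE eqxx orbT.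
by exists q' => //; move: q'L; rewrite !inE => /orP[|] -> //; rewrite !orbT.
Qed.

(** Only finitely many slopes occur. This makes the second dual potential integrable along the
    selection. *)
Lemma max_aff_slope_bounded (g : 'rV[R]_d -> R) q L :
  exists B, forall x, `|g (max_aff_slope q L x)| <= B.
Proof.
elim: L => [|q1 L [B IH]]; first by exists `|g q.1|.
exists (Num.max B `|g q1.1|) => x /=; rewrite le_max.
by case: ifPn => _; rewrite ?lexx ?orbT// IH.
Qed.

Lemma aff_bounded (M : R) q x : (forall i, `|x ord0 i| <= M) ->
  `|aff q x| <= \sum_(i < d) `|q.1 ord0 i| * M + `|q.2|.
Proof.
move=> xM; apply: le_trans (ler_normD _ _) _; rewrite lerD2r.
apply: le_trans (ler_norm_sum _ _ _) _; apply: ler_sum => i _.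
by rewrite normrM ler_wpM2l.
Qed.

Lemma max_aff_bounded (M : R) q L :
  exists B, forall x, (forall i, `|x ord0 i| <= M) -> `|max_aff q L x| <= B.
Proof.
exists (\big[Num.max/0]_(q' <- q :: L) (\sum_(i < d) `|q'.1 ord0 i| * M + `|q'.2|)) => x xM.
have [q' q'L [_ ->]] := max_aff_slopeP q L x.
exact: (bigmax_sup_seq _ q' _ _ _ q'L isT (aff_bounded q' xM)).
Qed.

(* v plays the role of the Legendre transform of max_aff, but only its values
   at the slopes matter. *)
Lemma max_aff_conjugate L : exists2 v : 'rV[R]_d -> R,
  measurable_fun [set: Rd R d] (v : Rd R d -> R) &
  forall q, q \in L -> v q.1 <= - q.2 /\
    exists2 q', q' \in L & q'.1 = q.1 /\ v q.1 = - q'.2.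
Proof.
elim: L => [|q L [v mv vP]]; first by exists (cst 0).
(* Pieces may share a slope, and then the least value of [- q.2] is kept. At a slope absent from [L]
   the old [v] is uncontrolled and is overwritten. *)
pose w (y : 'rV[R]_d) := if y == q.1 then
  (if q.1 \in map fst L then Num.min (- q.2) (v y) else - q.2) else v y.
exists w.
  apply: measurable_fun_ifT => //.
    apply: (@measurable_fun_bool _ _ _ _ true).
    rewrite setTI (_ : _ @^-1` _ = [set q.1]); first exact: singleton_measurable_Rd.
    by apply/seteqP; split=> y /= => [/eqP|->]//; rewrite eqxx.
  case: (q.1 \in _) => //; exact: measurable_minr.
move=> q1 q1L; rewrite /w; have [q1q|q1q] := eqVneq q1.1 q.1; last first.
  move: q1L; rewrite inE => /predU1P[q1E|]; first by rewrite q1E eqxx in q1q.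
  move=> /vP[vq1 [q' q'L q'P]]; split=> //; exists q' => //.
  by rewrite inE q'L orbT.
case: ifPn => qL; last first.
  suff -> : q1 = q by split; [exact: lexx|exists q => //; rewrite inE eqxx].
  move: q1L; rewrite inE => /predU1P[//|q1L].
  by move: qL; rewrite -q1q (map_f fst q1L).
move: qL => /mapP[q2 q2L q2E].
have [_ [q' q'L [q'E vE]]] := vP _ q2L; split.
  rewrite ge_min; move: q1L; rewrite inE => /predU1P[->|/vP[+ _]]; first by rewrite lexx.
  by rewrite q1q => ->; rewrite orbT.
rewrite q1q /Num.min; case: ifPn => _; first by exists q => //; rewrite inE eqxx.
by exists q'; [rewrite inE q'L orbT|rewrite q2E].
Qed.

End max_affine.

(** * Dual potentials and the one-sided estimate on the gap *)

Section gap.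
Context (R : realType) (d : nat).
Local Notation T := (Rd R d).
Implicit Types (q : 'rV[R]_d * R) (L : seq ('rV[R]_d * R)) (x y : 'rV[R]_d).

Definition sqnorm x : R := \sum_(i < d) x ord0 i ^+ 2.

Definition potential q L x : R := sqnorm x - 2 * max_aff q L x.

Lemma measurable_sqnorm : measurable_fun [set: T] (sqnorm : T -> R).
Proof.
by apply: measurable_sum => i; apply: measurable_funX; exact: measurable_coord.
Qed.

Lemma measurable_potential q L : measurable_fun [set: T] (potential q L : T -> R).
Proof.
apply: measurable_funB; first exact: measurable_sqnorm.
by apply: measurable_funM => //; exact: measurable_max_aff.
Qed.

(** [aff q x - q.2] is the inner product of [x] and [q.1], so this is the expansion of the square in
    a form comparable with [max_aff]. *)
Lemma sqdistE x q : sqdist x q.1 = sqnorm x + sqnorm q.1 - 2 * (aff q x - q.2).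
Proof.
rewrite /aff addrK /sqdist /sqnorm -big_split/= mulr_sumr -sumrB.
by apply: eq_bigr => i _; ring.
Qed.

Lemma potential_bounded (M : R) q L :
  exists B, forall x, (forall i, `|x ord0 i| <= M) -> `|potential q L x| <= B.
Proof.
have [B hB] := max_aff_bounded M q L.
exists (\sum_(i < d) M ^+ 2 + 2 * B) => x xM.
apply: le_trans (ler_normB _ _) _; apply: lerD; last first.
  by rewrite normrM ger0_norm// ler_wpM2l// hB.
rewrite ger0_norm; last by apply: sumr_ge0 => i _; exact: sqr_ge0.
by apply: ler_sum => i _; rewrite -real_normK ?num_real// lerXn2r ?nnegrE// (le_trans _ (xM i)).
Qed.

Context (mu1 mu2 : probability T R) (A K : set T) (M : R).
Hypotheses (mA : measurable A) (mu1A : mu1 A = 1%E) (mu2A : mu2 A = 1%E).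
Hypothesis AM : forall x, A x -> forall i, `|(x : 'rV[R]_d) ord0 i| <= M.

Lemma potential_integrable (mu : probability T R) q L : mu A = 1%E ->
  mu.-integrable setT (EFin \o (potential q L : T -> R)).
Proof.
move=> muA; have [B hB] := potential_bounded M q L.
apply: (prob_bounded_integrable mA muA); first exact: measurable_potential.
by move=> x Ax; apply: hB; exact: AM.
Qed.

Lemma W2sq_gap_le (c : R) q L : slopes_in K (q :: L) ->
  (forall nu : probability T R, nu K = 1%E ->
     (W2sq mu1 nu = W2sq mu2 nu + c%:E)%E) ->
  c <= \int[mu1]_x potential q L x - \int[mu2]_x potential q L x.
Proof.
move=> slK gap.
pose h : T -> T := max_aff_slope q L.
have mh : measurable_fun setT h by exact: measurable_max_aff_slope.
have [nu nuh] := prob_pushforward mu1 mh.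
have nuK : nu K = 1%E.
  rewrite nuh (_ : h @^-1` K = setT) ?probability_setT//; apply/seteqP; split=> // x _ /=.
  by rewrite /h; have [q' /slK Kq' [-> _]] := max_aff_slopeP q L x.
(* [v] is prescribed at the slopes alone, so the dual inequality is tested on this finite set, which
   carries [nu]. *)
pose S : set T := [set` map fst (q :: L)].
have mS : measurable S.
  rewrite /S; elim: (map fst _) => [|y s IH].
    by rewrite (_ : [set` _] = set0) //; apply/seteqP; split.
  rewrite (_ : [set` _] = [set y] `|` [set` s]).
    by apply: measurableU => //; exact: singleton_measurable_Rd.
  apply/seteqP; split=> z /=; rewrite inE; first by move=> /predU1P.
  by move=> h'; exact/predU1P.
have nuS : nu S = 1%E.
  rewrite nuh (_ : h @^-1` S = setT) ?probability_setT//; apply/seteqP; split=> // x _ /=.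
  by rewrite /h; have [q' q'L [-> _]] := max_aff_slopeP q L x; apply: map_f.
have [v mv vP] := max_aff_conjugate (q :: L).
pose psi (y : T) : R := sqnorm y - 2 * v y.
have mpsi : measurable_fun setT psi.
  by apply: measurable_funB; [exact: measurable_sqnorm|exact: measurable_funM].
have iphi1 := potential_integrable q L mu1A.
have iphi2 := potential_integrable q L mu2A.
have ipsih : mu1.-integrable setT (EFin \o (psi \o h)).
  have [B hB] := max_aff_slope_bounded psi q L.
  apply: (@prob_bounded_integrable _ _ _ _ setT _ B) => //.
  - exact: probability_setT.
  - exact: measurableT_comp.
  - by move=> x _; exact: hB.
have nuh' B : measurable B -> nu B = mu1 (h @^-1` B) by [].
have ipsi : nu.-integrable setT (EFin \o psi).
  by apply/(image_integrable mh nuh' mpsi).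
have lb : ((\int[mu2]_x potential q L x + \int[nu]_y psi y)%:E <= W2sq mu2 nu)%E.
  apply: (W2sq_ge_dual mA mS mu2A nuS) => //; first exact: measurable_potential.
  (* With [q2] a piece of the given slope at which [v] equals [- q2.2], the inequality reduces to
     [aff q2 x <= max_aff q L x]. *)
  move=> x _ _ /mapP[q' /vP[_ [q2 q2L [<- vE]]] ->].
  rewrite sqdistE /psi /potential vE.
  by have := aff_le_max x q2L; lra.
have ub : (W2sq mu1 nu <= (\int[mu1]_x potential q L x + \int[nu]_y psi y)%:E)%E.
  apply: le_trans (W2sq_le_image mh nuh') _.
  rewrite (image_Rintegral mh nuh')// -RintegralD//.
  have isum := integrableD measurableT iphi1 ipsih.
  rewrite /Rintegral fineK; last exact: integrable_fin_num isum.
  apply: ge0_le_integral => //.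
  - by move=> x _; rewrite lee_fin sqdist_ge0.
  - apply/measurable_EFinP.
    have mg : measurable_fun [set: T] (fun x : T => (x, h x) : T * T).
      by apply: measurable_fun_pair.
    exact: measurableT_comp (@measurable_sqdist R d) mg.
  - by have /integrableP[] := isum.
  - move=> x _; rewrite lee_fin /psi /potential /h.
    (* On the graph of [h] the piece [q'] attains the maximum, so [v q'.1 <= - q'.2] yields the
       reverse of the dual inequality. *)
    have [q' q'L [-> ->]] := max_aff_slopeP q L x.
    by rewrite sqdistE; have [+ _] := vP _ q'L; lra.
(* The integral of [psi] against [nu] occurs in both bounds and cancels. *)
have := le_trans (leeD2r c%:E lb) _; rewrite -gap// => /(_ _ ub).
by rewrite lee_fin; lra.
Qed.

End gap.

(** * Ramps approximating the indicator of a polytope *)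

Section gap_polytope.
Context (R : realType) (d : nat).
Local Notation T := (Rd R d).
Implicit Types (q : 'rV[R]_d * R) (L : seq ('rV[R]_d * R)) (x y : 'rV[R]_d).

Lemma aff_cst (a : R) x : aff (0, a) x = a.
Proof. by rewrite /aff big1 ?add0r// => i _; rewrite mxE mul0r. Qed.

(** The left maximum is attained at its head or at a piece common to both sides. With constant heads
    this compares the two terms of [ramp]. *)
Lemma max_aff_le_max q q' L x :
  max_aff q L x <= Num.max (aff q x) (max_aff q' L x).
Proof.
have [q1 q1L [_ ->]] := max_aff_slopeP q L x.
move: q1L; rewrite inE => /predU1P[->|q1L]; rewrite le_max ?lexx// aff_le_max ?orbT//.
by rewrite inE q1L orbT.
Qed.

(** For [e > 0], raising the intercepts shrinks the polytope, which gives an inner approximation. *)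
Definition raise (e : R) L := [seq (q.1, q.2 + e) | q <- L].

Lemma aff_raise e q x : aff (q.1, q.2 + e) x = aff q x + e.
Proof. by rewrite /aff addrA. Qed.

Lemma polytope_raiseP e L x : polytope (raise e L) x <-> forall q, q \in L -> aff q x < - e.
Proof.
rewrite /polytope/= all_map; split=> [/allP h q /h|h].
  by rewrite /= aff_raise; lra.
by apply/allP => q /h; rewrite /= aff_raise; lra.
Qed.

(** For [e > 0] and [m] the maximum of the pieces of [L], this is 1 where [m <= - e], 0 where
    [m >= 0], and [- m / e] in between. *)
Definition ramp (e : R) L x : R := (max_aff (0, 0) L x - max_aff (0, - e) L x) / e.

Lemma ramp_ge0 e L x : 0 < e -> 0 <= ramp e L x.
Proof.
move=> e0; rewrite divr_ge0 ?(ltW e0)// subr_ge0.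
have := max_aff_le_max (0, - e) (0, 0) L x; rewrite aff_cst => /le_trans; apply.
have := aff_le_max (L := L) x (mem_head (0, 0) L); rewrite aff_cst => h.
by rewrite ge_max lexx andbT; lra.
Qed.

Lemma ramp_le1 e L x : 0 < e -> ramp e L x <= 1.
Proof.
move=> e0; rewrite ler_pdivrMr// mul1r.
have := max_aff_le_max (0, 0) (0, - e) L x; rewrite aff_cst le_max.
have := aff_le_max (L := L) x (mem_head (0, - e) L); rewrite aff_cst => h.
by move=> /orP[] ?; lra.
Qed.

Lemma ramp_eq1 e L x : 0 < e -> polytope (raise e L) x -> ramp e L x = 1.
Proof.
move=> e0 /polytope_raiseP xL.
have cst a : - e <= a -> max_aff (0, a) L x = a.
  move=> ea; apply/eqP; rewrite eq_le; apply/andP; split; last first.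
    by have := aff_le_max (L := L) x (mem_head (0, a) L); rewrite aff_cst.
  have [q + [_ ->]] := max_aff_slopeP (0, a) L x.
  by rewrite inE => /predU1P[->|/xL]; [rewrite aff_cst|lra].
by rewrite /ramp !cst ?oppr_le0 ?(ltW e0)// sub0r opprK divff// gt_eqF.
Qed.

Lemma ramp_eq0 e L x : 0 < e -> ~ polytope L x -> ramp e L x = 0.
Proof.
move=> e0 /negP; rewrite -has_predC => /hasP[q qL /=]; rewrite -leNgt => q0.
have qx b : aff q x <= max_aff (0, b) L x by apply: aff_le_max; rewrite inE qL orbT.
rewrite /ramp; suff -> : max_aff (0, 0) L x = max_aff (0, - e) L x by rewrite subrr mul0r.
apply/eqP; rewrite eq_le; apply/andP; split.
  have := max_aff_le_max (0, 0) (0, - e) L x; rewrite aff_cst => /le_trans; apply.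
  by rewrite ge_max lexx andbT (le_trans q0).
have := max_aff_le_max (0, - e) (0, 0) L x; rewrite aff_cst => /le_trans; apply.
by rewrite ge_max lexx andbT; have := qx 0; lra.
Qed.

Lemma measurable_ramp e L : measurable_fun [set: T] (ramp e L : T -> R).
Proof.
by apply: measurable_funM => //; apply: measurable_funB; exact: measurable_max_aff.
Qed.

(** The ramp lies between the indicators of the shrunken and the full polytope, and its integral may
    be moved from [mu] to [nu]. *)
Lemma polytope_raise_le (mu nu : probability T R) e L : 0 < e ->
  (\int[mu]_x (ramp e L x)%:E = \int[nu]_x (ramp e L x)%:E)%E ->
  (mu (polytope (raise e L)) <= nu (polytope L))%E.
Proof.
move=> e0 eq_int.
have mP := @measurable_polytope R d.
have mr := measurable_ramp e L.
have muE (m : probability T R) L' : (m (polytope L') = \int[m]_x (\1_(polytope L') x)%:E)%E.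
  by rewrite integral_indic// setIT.
rewrite [leLHS]muE [leRHS]muE.
apply: (@le_trans _ _ (\int[mu]_x (ramp e L x)%:E)%E); last rewrite eq_int.
  apply: ge0_le_integral => //.
  - by apply/measurable_EFinP; exact: measurable_indic.
  - by apply/measurable_EFinP.
  - move=> x _; rewrite lee_fin indicE; have [|_] := boolP (x \in _); last exact: ramp_ge0.
    by rewrite inE => /(ramp_eq1 e0) ->.
apply: ge0_le_integral => //.
- by move=> x _; rewrite lee_fin ramp_ge0.
- by apply/measurable_EFinP.
- by apply/measurable_EFinP; exact: measurable_indic.
- move=> x _; rewrite lee_fin indicE; have [_|] := boolP (x \in _); first exact: ramp_le1.
  by rewrite notin_setE => /(ramp_eq0 e0) ->.
Qed.

(** Finitely many strict inequalities at a point hold with a common margin, taken by induction as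
    the smaller of two. *)
Lemma polytope_bigcup_raise L :
  polytope L = \bigcup_n polytope (raise n.+1%:R^-1 L).
Proof.
apply/seteqP; split=> x; last first.
  move=> [n _ /polytope_raiseP h]; apply/allP => q /h/lt_trans; apply.
  by rewrite oppr_lt0.
elim: L => [|q L IH]; first by exists 0%N.
move=> /andP[qx /IH[n _ /polytope_raiseP nL]].
have qx0 : 0 < - aff q x by rewrite oppr_gt0.
have [m _ /(_ m (leqnn m))/= mq] := near_infty_natSinv_lt (PosNum qx0).
exists (maxn m n) => //; apply/(@polytope_raiseP _ (q :: L)) => q'.
rewrite inE => /predU1P[->|/nL q'x].
  rewrite ltrNr; apply: le_lt_trans mq.
  by rewrite lef_pV2 ?posrE ?ltr0n// ler_nat ltnS leq_maxl.
apply: (lt_le_trans q'x); rewrite lerN2 lef_pV2 ?posrE ?ltr0n// ler_nat ltnS leq_maxr//.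
Qed.

(** The shrunken polytopes increase to the full one, so continuity from below applies to [mu] while
    the bound by [nu] stays fixed. *)
Lemma polytope_le (mu nu : probability T R) L :
  (forall e, 0 < e ->
    (\int[mu]_x (ramp e L x)%:E = \int[nu]_x (ramp e L x)%:E)%E) ->
  (mu (polytope L) <= nu (polytope L))%E.
Proof.
move=> eq_int; rewrite {1}polytope_bigcup_raise.
have cv : (mu (polytope (raise n.+1%:R^-1 L)) @[n --> \oo] -->
    mu (\bigcup_n polytope (raise n.+1%:R^-1 L)))%E.
  apply: nondecreasing_cvg_mu.
  - by move=> n; exact: measurable_polytope.
  - by apply: bigcupT_measurable => n; exact: measurable_polytope.
  - move=> m n mn; apply/subsetPset => x /polytope_raiseP h.
    apply/polytope_raiseP => q /h/lt_le_trans; apply.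
    by rewrite lerN2 lef_pV2 ?posrE ?ltr0n// ler_nat ltnS.
rewrite -(cvg_lim _ cv)//; apply: lime_le; first by apply/cvg_ex; eexists; exact: cv.
by near=> n; apply: polytope_raise_le => //; exact: eq_int.
Unshelve. all: by end_near.
Qed.

End gap_polytope.

(** * A constant gap forces equality of the measures *)

Section rigidity.
Context (R : realType) (d : nat).
Local Notation T := (Rd R d).
Context (mu1 mu2 : probability T R) (A : set T) (K : set 'rV[R]_d) (M c : R).
Hypotheses (mA : measurable A) (mu1A : mu1 A = 1%E) (mu2A : mu2 A = 1%E).
Hypothesis AM : forall x, A x -> forall i, `|(x : 'rV[R]_d) ord0 i| <= M.
Hypothesis K0 : (interior K) 0.
Hypothesis gap : forall nu : probability T R, prob_on K nu ->
  (W2sq mu1 nu = W2sq mu2 nu + c%:E)%E.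

Lemma integral_potential_gap q L : slopes_in K (q :: L) ->
  \int[mu1]_x potential q L x - \int[mu2]_x potential q L x = c.
Proof.
move=> slK; apply/eqP; rewrite eq_le; apply/andP; split; last first.
  exact: (W2sq_gap_le mA mu1A mu2A AM slK gap).
(* Exchanging the measures turns [c] into [- c] and gives the other inequality. *)
have gap' (nu : probability T R) : nu K = 1%E -> (W2sq mu2 nu = W2sq mu1 nu + (- c)%:E)%E.
  by move=> /gap ->; rewrite -addeA -EFinD subrr adde0.
by have := W2sq_gap_le mA mu2A mu1A AM slK gap'; lra.
Qed.

(** The ramp is a multiple of a difference of two potentials, in which [sqnorm] cancels. Both
    potentials have the same gap [c], which cancels too. *)
Lemma integral_ramp_eq e L : 0 < e -> slopes_in K L ->
  (\int[mu1]_x (ramp e L x)%:E = \int[mu2]_x (ramp e L x)%:E)%E.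
Proof.
move=> e0 LK.
(* The constant heads have slope 0, which belongs to [K]. *)
have slK a : slopes_in K ((0, a) :: L).
  move=> q; rewrite inE => /predU1P[->|/LK//] /=.
  exact: interior_subset K0.
have rampE (x : T) : ramp e L x =
    (2 * e)^-1 * (potential (0, - e) L x - potential (0, 0) L x).
  by rewrite /ramp /potential; field; lra.
have intE (mu : probability T R) : mu A = 1%E -> (\int[mu]_x (ramp e L x)%:E =
   ((2 * e)^-1 * (\int[mu]_x potential (0, - e) L x - \int[mu]_x potential (0, 0) L x))%:E)%E.
  move=> muA.
  have i1 := potential_integrable mA AM (0, - e) L muA.
  have i2 := potential_integrable mA AM (0, 0) L muA.
  have i12 := integrableB measurableT i1 i2.
  rewrite -RintegralB// -RintegralZl//.
  rewrite /Rintegral fineK; last first.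
    exact: integrable_fin_num (integrableZl measurableT (2 * e)^-1 i12).
  by apply: eq_integral => x _; rewrite rampE.
rewrite !intE//; congr (_ * _)%:E.
by have := integral_potential_gap (slK (- e)); have := integral_potential_gap (slK 0); lra.
Qed.

Lemma W2sq_gap_eq (B : set T) : measurable B -> mu1 B = mu2 B.
Proof.
apply: (polytope_measure_unique K0) => L LK; apply/eqP; rewrite eq_le.
apply/andP; split; apply: polytope_le => e e0; first exact: integral_ramp_eq.
by rewrite integral_ramp_eq.
Qed.

End rigidity.

(** * Finiteness of [W2sq] and properties of [D_CT] and [d_CT] *)

Section discrepancy.
Context (R : realType) (d : nat).
Local Notation T := (Rd R d).
Implicit Types (mu nu : probability T R).

Lemma bounded_set_coord (A : set 'rV[R]_d) : bounded_set A ->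
  exists M, forall x, A x -> forall i, `|x ord0 i| <= M.
Proof.
(* [bounded_set] provides a bound for each number strictly above [M], hence [M + 1]. *)
move=> [M [_ bA]]; exists (M + 1) => x Ax i.
apply: le_trans (bA (M + 1) _ x Ax); last by rewrite ltrDl.
rewrite [leRHS]mx_normrE.
exact: (le_bigmax _ (fun ij : 'I_1 * 'I_d => `|x ij.1 ij.2|) (ord0, i)).
Qed.

Context (Omega K : set 'rV[R]_d).
Hypotheses (mO : measurable (Omega : set T)) (mK : measurable (K : set T)).
Hypotheses (bO : bounded_set Omega) (bK : bounded_set K).

(** Finiteness makes each difference in [D_CT] a difference of reals, so the later inequalities are
    linear arithmetic. *)
Lemma W2sq_EFin mu nu : prob_on Omega mu -> prob_on K nu ->
  exists w, W2sq mu nu = w%:E.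
Proof.
move=> muO nuK.
have [M hM] := bounded_set_coord bO; have [N hN] := bounded_set_coord bK.
exists (fine (W2sq mu nu)); rewrite fineK//.
apply: (W2sq_fin_num (M := \sum_(i < d) (M + N) ^+ 2) mO mK muO nuK) => x y Ox Ky.
apply: ler_sum => i _; rewrite -real_normK ?num_real//.
have xM := hM x Ox i; have yN := hN y Ky i.
have xyMN := le_trans (ler_normB (x ord0 i) (y ord0 i)) (lerD xM yN).
by rewrite lerXn2r// ?nnegrE// (le_trans _ xyMN).
Qed.

Lemma D_CT_ge mu1 mu2 nu w1 w2 : prob_on K nu ->
  W2sq mu1 nu = w1%:E -> W2sq mu2 nu = w2%:E ->
  ((2^-1 * (w1 - w2))%:E <= D_CT K mu1 mu2)%E.
Proof.
move=> nuK w1E w2E; apply: ereal_sup_ubound; exists nu => //.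
by rewrite w1E w2E -!EFinM -EFinB mulrBr.
Qed.

(** The Dirac mass at 0 competes in both suprema, where its contributions are opposite. *)
Lemma d_CT_ge0 mu1 mu2 : K 0 -> prob_on Omega mu1 -> prob_on Omega mu2 ->
  (0 <= d_CT K mu1 mu2)%E.
Proof.
move=> K0 mu1O mu2O; pose nu : probability T R := @dirac _ T (0 : 'rV[R]_d) R.
have nuK : prob_on K nu by rewrite /prob_on /nu/= diracE mem_set.
have [w1 w1E] := W2sq_EFin mu1O nuK; have [w2 w2E] := W2sq_EFin mu2O nuK.
have := leeD (D_CT_ge nuK w1E w2E) (D_CT_ge nuK w2E w1E).
by rewrite -EFinD -mulrDr -opprB addNr mulr0.
Qed.

(** For each fixed [nu], [W2sq mu3 nu] is subtracted and added. *)
Lemma D_CT_triangle mu1 mu2 mu3 :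
  prob_on Omega mu1 -> prob_on Omega mu2 -> prob_on Omega mu3 ->
  (D_CT K mu1 mu2 <= D_CT K mu1 mu3 + D_CT K mu3 mu2)%E.
Proof.
move=> mu1O mu2O mu3O; apply: ge_ereal_sup => _ [nu nuK <-].
have [w1 w1E] := W2sq_EFin mu1O nuK; have [w2 w2E] := W2sq_EFin mu2O nuK.
have [w3 w3E] := W2sq_EFin mu3O nuK.
apply: le_trans (leeD (D_CT_ge nuK w1E w3E) (D_CT_ge nuK w3E w2E)).
by rewrite w1E w2E -!EFinM -EFinB -EFinD lee_fin; lra.
Qed.

Lemma d_CT_triangle mu1 mu2 mu3 :
  prob_on Omega mu1 -> prob_on Omega mu2 -> prob_on Omega mu3 ->
  (d_CT K mu1 mu2 <= d_CT K mu1 mu3 + d_CT K mu3 mu2)%E.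
Proof.
move=> mu1O mu2O mu3O; rewrite /d_CT addeACA [X in (_ <= _ + X)%E]addeC.
by apply: leeD; exact: D_CT_triangle.
Qed.

Lemma W2sq_eql mu1 mu2 nu : (forall B, measurable B -> mu1 B = mu2 B) ->
  W2sq mu1 nu = W2sq mu2 nu.
Proof.
move=> mu12; congr ereal_inf; apply/seteqP; split=> _ [pi [p1 p2] <-];
  by exists pi => //; split=> // B mB; rewrite p1// mu12.
Qed.

Lemma d_CT_eq0 mu1 mu2 : K 0 -> prob_on Omega mu1 ->
  (forall B, measurable B -> mu1 B = mu2 B) -> d_CT K mu1 mu2 = 0%E.
Proof.
move=> K0 mu1O mu12.
have mu2O : prob_on Omega mu2 by rewrite /prob_on -mu12.
have D0 (m1 m2 : probability T R) : prob_on Omega m1 -> (forall B, measurable B -> m1 B = m2 B) ->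
    (D_CT K m1 m2 <= 0)%E.
  move=> m1O m12; apply: ge_ereal_sup => _ [nu nuK <-].
  have [w wE] := W2sq_EFin m1O nuK.
  by rewrite -(W2sq_eql nu m12) wE -EFinM subee.
apply/eqP; rewrite eq_le d_CT_ge0// andbT -[leRHS]adde0.
by apply: leeD; apply: D0 => // B mB; rewrite mu12.
Qed.

(** Testing one discrepancy at [nu] and the other at the Dirac mass at 0 bounds half the difference
    of the two gaps by [d_CT]. Doing so in both orders shows that every gap equals the one at the
    Dirac mass. *)
Lemma d_CT_eq0_W2sq_gap mu1 mu2 : K 0 -> prob_on Omega mu1 -> prob_on Omega mu2 ->
  d_CT K mu1 mu2 = 0%E ->
  exists c, forall nu, prob_on K nu -> (W2sq mu1 nu = W2sq mu2 nu + c%:E)%E.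
Proof.
move=> K0 mu1O mu2O d0; pose nu0 : probability T R := @dirac _ T (0 : 'rV[R]_d) R.
have nu0K : prob_on K nu0 by rewrite /prob_on /nu0/= diracE mem_set.
have [v1 v1E] := W2sq_EFin mu1O nu0K; have [v2 v2E] := W2sq_EFin mu2O nu0K.
exists (v1 - v2) => nu nuK.
have [w1 w1E] := W2sq_EFin mu1O nuK; have [w2 w2E] := W2sq_EFin mu2O nuK.
have := leeD (D_CT_ge nuK w1E w2E) (D_CT_ge nu0K v2E v1E).
have := leeD (D_CT_ge nu0K v1E v2E) (D_CT_ge nuK w2E w1E).
rewrite -/(d_CT K mu1 mu2) d0 w1E w2E -!EFinD !lee_fin => h1 h2.
by congr _%:E; lra.
Qed.

End discrepancy.

(** * The distance axioms for [d_CT] *)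

Theorem theorem2 (R : realType) (d : nat)
    (Omega K : set 'rV[R]_d)
    (hOopen : open Omega) (hObdd : bounded_set Omega)
    (hOconv : convex_set (Omega : set (convex_lmodType 'rV[R]_d)))
    (hKcpt : compact K) (hK0 : (interior K) 0) :
  (forall mup mum : probability (Rd R d) R,
      prob_on Omega mup -> prob_on Omega mum ->
      (0 <= d_CT K mup mum)%E) /\
  (forall mup mum : probability (Rd R d) R,
      prob_on Omega mup -> prob_on Omega mum ->
      (d_CT K mup mum = 0%E <->
       (forall A : set (Rd R d), measurable A -> mup A = mum A))) /\
  (forall mu1 mu2 mu3 : probability (Rd R d) R,
      prob_on Omega mu1 -> prob_on Omega mu2 -> prob_on Omega mu3 ->
      (d_CT K mu1 mu2 <= d_CT K mu1 mu3 + d_CT K mu3 mu2)%E).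
Proof.
have K0 : K 0 by exact: interior_subset hK0.
have mO := open_measurable_Rd hOopen; have mK := compact_measurable_Rd hKcpt.
have bK := compact_bounded hKcpt.
split; first by move=> mup mum; exact: (d_CT_ge0 mO mK hObdd bK K0).
split; last by move=> mu1 mu2 mu3; exact: (d_CT_triangle mO mK hObdd bK).
move=> mup mum mupO mumO; split; last exact: (d_CT_eq0 mO mK hObdd bK K0 mupO).
move=> /(d_CT_eq0_W2sq_gap mO mK hObdd bK K0 mupO mumO)[c gap] B mB.
have [M hM] := bounded_set_coord hObdd.
exact: (W2sq_gap_eq mO mupO mumO hM hK0 gap).
Qed.
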